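(* Let $\sigma$ be a partition of the set of all primes and let $G\neq 1$ be a finite group. (1) We have $$\Gamma_{\sigma Hal}(G)\subseteq\Gamma_{\mathfrak{N}_\sigma}(G)\subseteq\Gamma_{H\sigma}(G).$$ Moreover, in general, both inclusions may be strict (that is, there exist finite groups $G$ and partitions $\sigma$ for which the first inclusion is strict, and there exist such for which the second inclusion is strict). (2) The equalities $$\Gamma_{\sigma Hal}(G)=\Gamma_{\mathfrak{N}_\sigma}(G)=\Gamma_{H\sigma}(G)$$ hold if and only if the graph $\Gamma_{H\sigma}(G)$ has no loops, that is (equivalently), $G$ is $\sigma$-soluble with $l_{\sigma_i}(G)\leq 1$ for all $\sigma_i\in\sigma(G)$.
   Context: All groups are finite. $\mathbb{P}$ is the set of all primes, $\pi(n)$ is the set of primes dividing the integer $n$, and $\pi(G)=\pi(|G|)$. $\sigma=\{\sigma_i\mid i\in I\}$ is a partition of $\mathbb{P}$: $\mathbb{P}=\bigcup_{i\in I}\sigma_i$ and $\sigma_i\cap\sigma_j=\emptyset$ for $i\ne j$. Put $\sigma(n)=\{\sigma_i\mid \sigma_i\cap\pi(n)\neq\emptyset\}$ and $\sigma(G)=\sigma(|G|)$. For a set of primes $\pi$, a $\pi$-group is a group $X$ with $\pi(X)\subseteq\pi$; a Hall $\pi$-subgroup is a $\pi$-subgroup whose index is divisible by no prime in $\pi$. A chief factor $H/K$ of $G$ is $\sigma$-central in $G$ if for some $i$ both $H/K$ and $G/C_G(H/K)$ are $\sigma_i$-groups. $G$ is: $\sigma$-soluble if every chief factor of $G$ is a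 $\sigma_i$-group for some $i$ (depending on the factor); $\sigma$-nilpotent if every chief factor of $G$ is $\sigma$-central in $G$; $\{\sigma_i\}$-nilpotent if every chief factor $H/K$ of $G$ with $\pi(H/K)\cap\sigma_i\neq\emptyset$ is $\sigma$-central in $G$. $F_{\{\sigma_i\}}(G)$ is the largest normal $\{\sigma_i\}$-nilpotent subgroup of $G$. $\mathfrak{N}_\sigma$ is the class of all $\sigma$-nilpotent groups; an $\mathfrak{N}_\sigma$-critical group is a non-$\sigma$-nilpotent group all of whose proper subgroups are $\sigma$-nilpotent. The following are directed graphs with vertex set $\sigma(G)$. $\Gamma_{H\sigma}(G)$ ($\sigma$-Hawkes graph): $(\sigma_i,\sigma_j)$ is an edge iff $\sigma_j\in\sigma(G/F_{\{\sigma_i\}}(G))$. $\Gamma_{\sigma Hal}(G)$ ($\sigma$-Hall graph): $(\sigma_i,\sigma_j)$ is an edge iff for some Hall $\sigma_i$-subgroup $H$ of $G$ we have $\sigma_j\in\sigma(N_G(H)/HC_G(H))$. $\Gamma_{\mathfrak{N}_\sigma}(G)$ ($\sigma$-Vasil'ev-Murashko graph): $(\sigma_i,\sigma_j)$ is an edge iff for some $\mathfrak{N}_\sigma$-critical subgroup $H$ of $G$ we have $\sigma_i\in\sigma(H)$ and $\sigma_j\in\sigma(H/F_{\{\sigma_i\}}(H))$. A loop is an edge $(\sigma_i,\sigma_i)$. $\Gamma_1\subseteq\Gamma$ means that $\Gamma_1$ is a subgraph of $\Gamma$: vertex set and edge set of $\Gamma_1$ are contained in those of $\Gamma$. For a set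 of primes $\pi$ and a $\pi$-separable group $G$ (one having a normal series whose factors are each a $\pi$-group or a $\pi'$-group), the $\pi$-length $l_\pi(G)$ is the least possible number of $\pi$-factors in such a series (equivalently, the number of nontrivial $\pi$-factors in the upper $\pi'\pi$-series $1\le O_{\pi'}(G)\le O_{\pi'\pi}(G)\le O_{\pi'\pi\pi'}(G)\le\cdots$). *)

(* Defs.v *)
From mathcomp Require Import all_boot all_fingroup all_solvable boolp.

Set Implicit Arguments.
Unset Strict Implicit.
Unset Printing Implicit Defensive.

Local Open Scope group_scope.

(* A partition is given by its indexed family of classes; since nonempty      *)
(* classes have distinct indices, sigma_i is represented by i throughout.     *)
(* An empty class belongs to no sigma(n), so it need not be excluded.         *)
Definition prime_partition (I : Type) (sigma : I -> nat_pred) : Prop :=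
  [/\ forall i p, p \in sigma i -> prime p,
      forall p, prime p -> exists i, p \in sigma i
    & forall i j p, i <> j -> p \in sigma i -> p \notin sigma j].

(* i \in sigma(n) *)
Definition in_sigma (I : Type) (sigma : I -> nat_pred) (n : nat) (i : I) :
    Prop :=
  exists2 p, p \in \pi(n) & p \in sigma i.

Section GroupClasses.

Variables (I : Type) (sigma : I -> nat_pred) (gT : finGroupType).
Implicit Types G H K N : {group gT}.

(* Here 'C_G(H / K | 'Q) is the centraliser C_G(H/K) of the section H/K in G. *)
Definition sigma_central G H K : Prop :=
  exists i, (sigma i).-group (H / K)
         /\ (sigma i).-group (G / 'C_G(H / K | 'Q)).

Definition sigma_soluble G : Prop :=
  forall H K, chief_factor G K H -> exists i, (sigma i).-group (H / K).

Definition sigma_nilpotent G : Prop :=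
  forall H K, chief_factor G K H -> sigma_central G H K.

Definition sigma1_nilpotent (i : I) G : Prop :=
  forall H K, chief_factor G K H ->
    in_sigma sigma #|H / K| i -> sigma_central G H K.

(* The largest normal {sigma_i}-nilpotent subgroup F_{sigma_i}(G), obtained   *)
(* as the product of all of them (see sigma1_FittingP below).                 *)
Definition sigma1_Fitting (i : I) G : {group gT} :=
  (\prod_(N : {group gT} | (N <| G) && `[< sigma1_nilpotent i N >]) N)%G.

Definition Nsigma_critical H : Prop :=
  ~ sigma_nilpotent H
  /\ (forall K : {group gT}, K \proper H -> sigma_nilpotent K).

End GroupClasses.

Section Sigma1Fitting.

Variables (I : Type) (sigma : I -> nat_pred) (gT : finGroupType).
Hypothesis sigmaP : prime_partition sigma.
Implicit Types (i : I) (G H K L N Q : {group gT}).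

Lemma chief_factor_above G K :
  K <| G -> K :!=: G -> exists H : {group gT}, chief_factor G K H.
Proof.
move=> nsKG neqKG.
have: [pred H : {group gT} | (K \proper H) && (H <| G)] G.
  by rewrite /= normal_refl andbT properEneq neqKG normal_sub.
case/mingroup_exists=> H /mingroupP[/= /andP[prKH nsHG] minH] _.
exists H; rewrite /chief_factor nsHG andbT.
apply/maxgroupP; split=> [|N /andP[prNH nNG] sKN].
  by rewrite prKH normal_norm.
apply/eqP; rewrite eq_sym; apply/negPn/negP=> neqKN.
have prKN : K \proper N by rewrite properEneq neqKN.
have nsNG : N <| G.
  by rewrite /normal nNG (subset_trans (proper_sub prNH) (normal_sub nsHG)).
have defN := minH N; rewrite /= prKN nsNG in defN.
by have := proper_neq prNH; rewrite (defN isT (proper_sub prNH)) eqxx.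
Qed.

Lemma sigma_central_pgroup i G H K :
    in_sigma sigma #|H / K| i -> sigma_central sigma G H K ->
  (sigma i).-group (H / K) /\ (sigma i).-group (G / 'C_G(H / K | 'Q)).
Proof.
case=> p pi_p sig_p [j [pH pG]].
suff -> : i = j by [].
apply: contrapT => neq_ij; have [_ _ tI] := sigmaP.
have /negP[] := tI _ _ _ neq_ij sig_p.
have := pi_p; rewrite mem_primes => /and3P[pr_p _ p_dv].
by move/pgroupP: pH; apply.
Qed.

Lemma not_in_sigma (hT : finGroupType) i (G : {group hT}) :
  ~ in_sigma sigma #|G| i -> (sigma i)^'.-group G.
Proof.
move=> notG; apply/pgroupP=> p pr_p p_dv; apply/negP=> sig_p; apply: notG.
by exists p; rewrite // mem_primes pr_p cardG_gt0.
Qed.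

Lemma sigma1_nilpotent_complement i G (B : {group gT}) :
    sigma1_nilpotent sigma i G -> B <| G ->
  exists Q, [/\ Q <| G, B \subset Q, (sigma i)^'.-group (Q / B)
              & (sigma i).-group (G / Q)].
Proof.
move=> nilG; have [n] := ubnP #|G : B|.
elim: n B => // n IHn B /ltnSE-leGn nsBG.
have [eqBG | neqBG] := eqVneq (B : {set gT}) (G : {set gT}).
  by exists G; rewrite eqBG trivg_quotient !pgroup1 normal_refl.
have [H chH] := chief_factor_above nsBG neqBG.
have /andP[/maxgroupp/andP[prBH _] nsHG] := chH.
have sBH := proper_sub prBH.
have ltGH : #|G : H| < #|G : B|.
  by rewrite -!divgS ?normal_sub // ltn_divLR ?cardSg ?normal_sub //
    divn_mulAC ?cardSg ?normal_sub // ltn_divRL ?ltn_pmul2l ?proper_card //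
    dvdn_mulr ?cardSg ?normal_sub.
have [Q [nsQG sHQ p'Q pGQ]] := IHn H (leq_trans ltGH leGn) nsHG.
have sBQ := subset_trans sBH sHQ.
have [nsBQ nsHQ] : B <| Q /\ H <| Q.
  by split; apply: normalS (normal_sub nsQG) _.
have isoQ := third_isog sBH nsBQ nsHQ.
have nsHBQB := quotient_normal B nsHQ.
have [inH | notH] := pselect (in_sigma sigma #|H / B| i); last first.
  exists Q; split=> //.
  rewrite /pgroup -(Lagrange (quotientS B sHQ)) pnatM.
  rewrite -card_quotient ?normal_norm // (card_isog isoQ).
  apply/andP; split; last exact: p'Q.
  exact: not_in_sigma.
have [pHB pGC] := sigma_central_pgroup inH (nilG _ _ chH inH).
have hallHB : (sigma i).-Hall(Q / B) (H / B).
  rewrite /pHall quotientS // pHB -card_quotient ?normal_norm //.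
  by rewrite (card_isog isoQ).
have /splitsP[L /complP[tiHL defQ]] :=
  SchurZassenhaus_split (pHall_Hall hallHB) nsHBQB.
have hallL : (sigma i)^'.-Hall(Q / B) L.
  by rewrite -(compl_pHall _ hallHB); apply/complP.
have nBG := normal_norm nsBG.
have sHG := normal_sub nsHG.
pose C := 'C_G(H / B | 'Q)%G; have {}pGC : (sigma i).-group (G / C) := pGC.
have nHBB : G / B \subset 'N(H / B) by rewrite quotient_norms ?normal_norm.
have defC : C / B = 'C_(G / B)(H / B).
  rewrite -[in RHS](quotient_astabQ (H / B)) /C.
  by rewrite /= quotientIG //= astabQ sub_cosetpre.
have sBC : B \subset C.
  rewrite subsetI normal_sub // sub_astabQ normG /=.
  by rewrite trivg_quotient sub1G.
have nsCBGB : C / B <| G / B.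
  by rewrite defC /normal subsetIl normsI ?normG ?norms_cent.
have nsCG : C <| G.
  have nsBC : B <| C by apply: normalS nsBG => //; apply: subsetIl.
  by rewrite -(quotientGK nsBG) -(quotientGK nsBC) cosetpre_normal.
have pGBC : (sigma i).-group (G / B / (C / B)).
  by rewrite /pgroup (card_isog (third_isog sBC nsBG nsCG)).
have sLQ : L \subset Q / B by rewrite (pHall_sub hallL).
have sQGB : Q / B \subset G / B by rewrite quotientS ?normal_sub.
have sLG := subset_trans sLQ sQGB.
have nCL := subset_trans sLG (normal_norm nsCBGB).
have cHL : L \subset 'C(H / B).
  suff: L \subset C / B by rewrite defC subsetI => /andP[].
  rewrite -quotient_sub1 // -(coprime_TIg (G := L / (C / B)) (H := L / (C / B))).
    by rewrite setIid.
  apply: (@pnat_coprime (sigma i)).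
    exact: pgroupS (quotientS _ sLG) pGBC.
  exact: quotient_pgroup (pHall_pgroup hallL).
have nsLQ : L <| Q / B.
  by rewrite /normal sLQ -defQ mul_subG ?normG // cents_norm // centsC.
have nsLG : L <| G / B.
  rewrite -(normal_Hall_pcore hallL nsLQ).
  by rewrite (char_normal_trans (pcore_char _ _)) ?quotient_normal.
have [K defL sBK nsKG] := inv_quotientN nsBG nsLG.
exists K; split=> //; first by rewrite -defL (pHall_pgroup hallL).
rewrite /pgroup -(card_isog (third_isog sBK nsBG nsKG)) -defL.
rewrite card_quotient ?normal_norm // -(Lagrange_index sQGB sLQ) pnatM.
apply/andP; split.
  rewrite -card_quotient ?normal_norm ?quotient_normal //.
  by rewrite (card_isog (third_isog sBQ nsBG nsQG)).
have /and3P[_ _] := hallL.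
by rewrite /pnat => /andP[-> /allP h]; apply/allP=> p /h; rewrite !inE negbK.
Qed.

Lemma sigma1_nilpotentE i G :
  sigma1_nilpotent sigma i G <->
  (sigma i).-group (G / 'O_(sigma i)^'(G)).
Proof.
split=> [nilG | pGQ H K chHK inHK].
  have [Q [nsQG _ p'Q pGQ]] := sigma1_nilpotent_complement nilG (normal1 G).
  have sQO : Q \subset 'O_(sigma i)^'(G).
    apply: pcore_max => //.
    by rewrite /pgroup (card_isog (quotient1_isog Q)).
  have nsOG := pcore_normal (sigma i)^' G.
  by rewrite /pgroup -(card_isog (third_isog sQO nsQG nsOG));
    exact: quotient_pgroup.
have /andP[maxK nsHG] := chHK.
have /maxgroupP[/andP[prKH nKG] maxK'] := maxK.
have sHG := normal_sub nsHG; have sKH := proper_sub prKH.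
have nsKG : K <| G by rewrite /normal (subset_trans sKH sHG).
set Q := 'O_(sigma i)^'(G) in pGQ.
have nsQG : Q <| G := pcore_normal _ _.
have p'Q : (sigma i)^'.-group Q := pcore_pgroup _ _.
have nKQ := subset_trans (normal_sub nsQG) nKG.
have nKH := subset_trans sHG nKG.
have nsKH : K <| H by rewrite /normal sKH.
have nsMG : K <*> (H :&: Q) <| G by rewrite normalY ?normalI.
have sHQK : H :&: Q \subset K.
  apply/idPn=> notHQK; pose M := (K <*> (H :&: Q))%G.
  have sMH : M \subset H by rewrite join_subG sKH subsetIl.
  have defM : M :=: H.
    apply/eqP/idPn=> neqMH; case/negP: notHQK.
    rewrite -(maxK' M) ?joing_subr ?joing_subl //.
    by rewrite properEneq neqMH sMH normal_norm.
  have p'HK : (sigma i)^'.-group (H / K).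
    rewrite -defM quotientYidl; last first.
      by apply: subset_trans nKQ; apply: subsetIr.
    by apply: quotient_pgroup; apply: pgroupS p'Q; apply: subsetIr.
  case: inHK => p; rewrite mem_primes => /and3P[pr_p _ p_dv] sig_p.
  by have := pgroupP p'HK p pr_p p_dv; rewrite inE /= sig_p.
exists i; split.
  have nQH := subset_trans sHG (normal_norm nsQG).
  have: (sigma i).-group (H / (H :&: Q)).
    rewrite /pgroup setIC (card_isog (second_isog nQH)).
    exact: pgroupS (quotientS _ sHG) pGQ.
  have nsI : H :&: Q <| H.
    by rewrite /normal subsetIl normsI ?normG.
  by move=> pHI; rewrite /pgroup -(card_isog (third_isog sHQK nsI nsKH));
    exact: quotient_pgroup.
have sQC : Q \subset 'C_G(H / K | 'Q).
  rewrite subsetI normal_sub // sub_astabQR //.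
  rewrite (subset_trans _ sHQK) // subsetI commg_subr commg_subl.
  rewrite (subset_trans (normal_sub nsQG) (normal_norm nsHG)).
  exact: subset_trans sHG (normal_norm nsQG).
have nsCG : 'C_G(H / K | 'Q) <| G.
  have sKC : K \subset 'C_G(H / K | 'Q).
    rewrite subsetI normal_sub // sub_astabQ normG /=.
    by rewrite trivg_quotient sub1G.
  have nsKC : K <| 'C_G(H / K | 'Q).
    by apply: normalS nsKG => //; apply: subsetIl.
  pose C := 'C_G(H / K | 'Q)%G; have {}nsKC : K <| C := nsKC.
  suff: C <| G by [].
  rewrite -(quotientGK nsKG) -(quotientGK nsKC).
  rewrite cosetpre_normal /= quotientIG; last by rewrite /= astabQ sub_cosetpre.
  rewrite quotient_astabQ.
  by rewrite /normal subsetIl normsI ?normG ?norms_cent ?quotient_norms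
    ?normal_norm.
by rewrite /pgroup -(card_isog (third_isog sQC nsQG nsCG));
    exact: quotient_pgroup.
Qed.

Lemma sigma1_nilpotentY i G (M N : {group gT}) :
    M <| G -> N <| G -> sigma1_nilpotent sigma i M ->
    sigma1_nilpotent sigma i N ->
  sigma1_nilpotent sigma i (M <*> N)%G.
Proof.
move=> nsMG nsNG /sigma1_nilpotentE pM /sigma1_nilpotentE pN.
apply/sigma1_nilpotentE; set O := 'O_ _(_ <*> _).
have nsMY : M <| M <*> N.
  by rewrite (normalS _ _ nsMG) ?joing_subl // join_subG !normal_sub.
have nsNY : N <| M <*> N.
  by rewrite (normalS _ _ nsNG) ?joing_subr // join_subG !normal_sub.
have nsOY : O <| M <*> N := pcore_normal _ _.
have aux L : L <| M <*> N -> (sigma i).-group (L / 'O_(sigma i)^'(L)) ->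
    (sigma i).-group (L / O).
  move=> nsLY pL.
  have sO : 'O_(sigma i)^'(L) \subset O :&: L.
    rewrite subsetI pcore_sub andbT pcore_max ?pcore_pgroup //.
    by rewrite (char_normal_trans (pcore_char _ _)).
  have nOL : L \subset 'N(O) :=
    subset_trans (normal_sub nsLY) (normal_norm nsOY).
  have nsOL : O :&: L <| L by rewrite /normal subsetIr normsI ?normG.
  rewrite /pgroup -(card_isog (second_isog nOL)).
  by rewrite -(card_isog (third_isog sO (pcore_normal _ _) nsOL));
    exact: quotient_pgroup.
rewrite /= norm_joinEr; last first.
  exact: subset_trans (normal_sub nsNG) (normal_norm nsMG).
rewrite quotientMl ?(subset_trans (normal_sub nsMY) (normal_norm nsOY)) //.
by rewrite pgroupM !aux.
Qed.

Lemma sigma1_FittingP i G :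
  [/\ sigma1_Fitting sigma i G <| G,
      sigma1_nilpotent sigma i (sigma1_Fitting sigma i G)
    & forall N, N <| G -> sigma1_nilpotent sigma i N ->
        N \subset sigma1_Fitting sigma i G].
Proof.
have [nsFG nilF] : sigma1_Fitting sigma i G <| G
    /\ sigma1_nilpotent sigma i (sigma1_Fitting sigma i G).
  rewrite /sigma1_Fitting.
  elim/big_ind: _ => [|M N [nsM nilM] [nsN nilN]|N /andP[nsN /asboolP nilN]] //.
    split; first exact: normal1.
    by apply/sigma1_nilpotentE/quotient_pgroup/pgroup1.
  by split; [apply: normalY | apply: sigma1_nilpotentY nsM nsN nilM nilN].
split=> // N nsNG nilN.
rewrite /sigma1_Fitting bigprodGE sub_gen //.
by apply: (bigcup_sup N); rewrite // nsNG; apply/asboolP.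
Qed.
End Sigma1Fitting.

Section PiLength.

Variables (pi : nat_pred) (gT : finGroupType).
Implicit Types (G : {group gT}) (s : seq {group gT}).

(* 1 :: s is a normal series of G all of whose factors are pi- or pi'-groups. *)
Definition pi_series G s : bool :=
  [&& (G.-invariant).-series 1%G s, last 1%G s == G
    & path [rel K H : {group gT} | pi.-group (H / K) || pi^'.-group (H / K)]
           1%G s].

Definition num_pi_factors s : nat :=
  count id (pairmap (fun K H : {group gT} => pi.-group (H / K)) 1%G s).

Definition pi_separable G : Prop := exists s, pi_series G s.

Definition has_pi_factors G (n : nat) : bool :=
  `[< exists2 s, pi_series G s & num_pi_factors s = n >].

(* The pi-length is meaningful for pi-separable groups only; the value 0 for  *)
(* other groups is a dummy.                                                   *)
Definition pi_length G : nat :=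
  if pselect (exists n, has_pi_factors G n) is left ex_n then ex_minn ex_n
  else 0.

End PiLength.

Record digraph (V : Type) := Digraph {
  vertex : V -> Prop;
  edge : V -> V -> Prop
}.

Definition subgraph (V : Type) (A B : digraph V) : Prop :=
  (forall x, vertex A x -> vertex B x)
  /\ (forall x y, edge A x y -> edge B x y).

Definition proper_subgraph (V : Type) (A B : digraph V) : Prop :=
  subgraph A B /\ A <> B.

Definition loopless (V : Type) (A : digraph V) : Prop :=
  forall x, ~ edge A x x.

Section Graphs.

Variables (I : Type) (sigma : I -> nat_pred) (gT : finGroupType).
Implicit Types G H : {group gT}.

Definition sigma_digraph G (E : I -> I -> Prop) : digraph I :=
  {| vertex := in_sigma sigma #|G|;
     edge := fun i j =>
       [/\ in_sigma sigma #|G| i, in_sigma sigma #|G| j & E i j] |}.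

Definition sigma_Hawkes_graph G : digraph I :=
  sigma_digraph G (fun i j =>
    in_sigma sigma #|G / sigma1_Fitting sigma i G| j).

Definition sigma_Hall_graph G : digraph I :=
  sigma_digraph G (fun i j =>
    exists2 H : {group gT}, (sigma i).-Hall(G) H
      & in_sigma sigma #|'N_G(H) / (H <*> 'C_G(H))| j).

Definition sigma_VM_graph G : digraph I :=
  sigma_digraph G (fun i j =>
    exists H : {group gT},
      [/\ H \subset G, Nsigma_critical sigma H, in_sigma sigma #|H| i
        & in_sigma sigma #|H / sigma1_Fitting sigma i H| j]).

End Graphs.

(* Main.v *)
(* With pi = sigma_i, a group is {sigma_i}-nilpotent iff it has a normal Hall
   pi'-subgroup, so F_{sigma_i}(G) = O_{pi'pi}(G), and a loop of the Hawkes
   graph at sigma_i is exactly the obstruction to G having pi-length <= 1.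
   The first inclusion takes a critical subgroup of A P, where the sigma_j-group
   P normalises but does not centralise the sigma_i-group A; the second is
   F_{sigma_i}(G) :&: H <= F_{sigma_i}(H).  The Hall graph never has loops, so
   equality forbids them; conversely, when G / O_{pi'pi}(G) is a pi'-group, some
   Hall pi-subgroup H satisfies G = O_{pi'}(G) N_G(H) and
   H C_G(H) <= O_{pi'pi}(G), whence |G : O_{pi'pi}(G)| divides
   |N_G(H) : H C_G(H)|.  Both inclusions are strict for Sym(4) and the partition
   of the primes by parity. *)
Require Import Defs.
From mathcomp Require Import all_boot all_fingroup all_solvable.
From mathcomp Require Import integral_char boolp.

Set Implicit Arguments.
Unset Strict Implicit.
Unset Printing Implicit Defensive.

Local Open Scope group_scope.

(** * Orders of pi-groups, their extensions and quotients *)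

Lemma pi_pi'_group1 (pi : nat_pred) (gT : finGroupType) (G : {group gT}) :
  pi.-group G -> pi^'.-group G -> G :=: 1.
Proof.
move=> piG pi'G; rewrite -(setIid G).
exact: coprime_TIg (pnat_coprime piG pi'G).
Qed.

Lemma pgroup_extension (pi : nat_pred) (gT : finGroupType) (G N : {group gT}) :
  N <| G -> pi.-group N -> pi.-group (G / N) -> pi.-group G.
Proof.
move=> /andP[sNG nNG] piN; rewrite /pgroup card_quotient // => piGN.
by rewrite -(Lagrange sNG) pnatM; apply/andP.
Qed.

Lemma pgroup_quotientS (pi : nat_pred) (gT : finGroupType)
    (G M N : {group gT}) :
  M <| G -> N <| G -> M \subset N -> pi.-group (G / M) -> pi.-group (G / N).
Proof.
move=> nMG nNG sMN; rewrite /pgroup !card_quotient ?normal_norm //.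
by apply: pnat_dvd; apply: indexgS.
Qed.

Lemma quotient_pgroup_trans (pi : nat_pred) (gT : finGroupType)
    (G K L : {group gT}) :
  K <| G -> L <| G -> K \subset L ->
  pi.-group (L / K) -> pi.-group (G / L) -> pi.-group (G / K).
Proof.
move=> nsKG nsLG sKL; have [sLG nLG] := andP nsLG; have [_ nKG] := andP nsKG.
rewrite /pgroup !card_quotient ?(subset_trans sLG) // => piLK piGL.
by rewrite -(Lagrange_index sLG sKL) pnatM piGL.
Qed.

Lemma invariant_series_sub_last (gT : finGroupType) (G K : {group gT})
    (s : seq {group gT}) :
  (G.-invariant).-series K s -> K \subset last K s.
Proof.
elim: s K => //= L s IHs K /andP[/and3P[_ _ /andP[sKL _]] /IHs].
exact: subset_trans.
Qed.

(** * Normal series with pi- and pi'-factors, and pi-length at most one *)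

Section PiLengthOne.

Variables (pi : nat_pred) (gT : finGroupType).
Implicit Types (G H K L Q : {group gT}) (s : seq {group gT}).

(** As in the Jordan-Holder argument, take the first term [N1] of the series with [H :&: N1] not
    inside [K]. Maximality of [K] gives H = K (H :&: N1), so |H / K| divides the order of the factor
    [N1 / N0]. *)
Lemma pi_series_chief_factor G s H K :
  pi_series pi G s -> chief_factor G K H ->
  pi.-group (H / K) || pi^'.-group (H / K).
Proof.
case/and3P=> inv_s /eqP last_s fact_s chHK.
have /andP[maxK nsHG] := chHK.
have /maxgroupP[/andP[prKH nKG] maxK'] := maxK.
have [sHG nHG] := andP nsHG; have sKH := proper_sub prKH.
(* Invariant of the induction along the series; it must fail before the last term [G], because [H]
   is not inside [K]. *)
have: H :&: 1%G \subset K by rewrite setIg1 sub1G.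
elim: s 1%G inv_s last_s fact_s => [|N1 s IHs] N0 /=.
  by move=> _ -> _; rewrite (setIidPl sHG) (negPf (proper_subn prKH)).
move=> /andP[/and3P[nN0G nN1G nsN01] inv_s] last_s /andP[piN fact_s] sHN0K.
have [/(IHs _ inv_s last_s fact_s) //|notHN1K] := boolP (H :&: N1 \subset K).
have nKHN1 : H :&: N1 \subset 'N(K) by rewrite subIset // (subset_trans sHG).
have defH : H :=: K * (H :&: N1).
  rewrite -norm_joinEr //; apply/eqP/idPn => neqH; case/negP: notHN1K.
  have prY : K <*> (H :&: N1) \proper H.
    by rewrite properEneq eq_sym neqH join_subG sKH subsetIl.
  apply: subset_trans (joing_subr K _) _.
  by rewrite (maxK' (K <*> (H :&: N1))%G) ?joing_subl //= prY normsY ?normsI.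
(* |H : K| = |H :&: N1 : K| divides |H :&: N1 : N0| by the invariant, and the latter equals |N0 (H
   :&: N1) : N0|, a divisor of |N1 : N0|. *)
have dvHK : #|H / K| %| #|N1 / N0|.
  rewrite !card_quotient ?(normal_norm nsN01) ?(subset_trans sHG) //.
  have [sN01 nN01] := andP nsN01.
  rewrite {1}defH indexMg; apply: (@dvdn_trans #|H :&: N1 : N0|).
    rewrite -(indexgI _ K) -(indexgI _ N0) indexgS // subsetI subsetIl.
    by apply: subset_trans sHN0K; rewrite setSI ?subsetIl.
  rewrite -indexMg -norm_joinEr ?(subset_trans (subsetIr _ _)) //.
  by rewrite indexSg ?joing_subl // join_subG sN01 subsetIr.
by case/orP: piN => piN; rewrite /pgroup (pnat_dvd dvHK piN) ?orbT.
Qed.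

Lemma pi_length_witness G :
  pi_separable pi G ->
  exists2 s, pi_series pi G s & num_pi_factors pi s = pi_length pi G.
Proof.
case=> s0 ser_s0; rewrite /pi_length; case: pselect => [ex_n|[]].
  by case: ex_minnP => n /asboolP.
by exists (num_pi_factors pi s0); apply/asboolP; exists s0.
Qed.

Lemma pi_length_le G s :
  pi_series pi G s -> pi_length pi G <= num_pi_factors pi s.
Proof.
move=> ser_s; rewrite /pi_length; case: pselect => // ex_n.
by case: ex_minnP => n _; apply; apply/asboolP; exists s.
Qed.

Lemma pi'_series_quotient G K s :
    K <| G -> (G.-invariant).-series K s -> last K s = G ->
    path [rel K H : {group gT} | pi.-group (H / K) || pi^'.-group (H / K)]
         K s ->
    count id (pairmap (fun K H : {group gT} => pi.-group (H / K)) K s) = 0 ->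
  pi^'.-group (G / K).
Proof.
elim: s K => [|L s IHs] K nsKG /=.
  by move=> _ -> _ _; rewrite trivg_quotient pgroup1.
move=> /andP[/and3P[_ nLG /andP[sKL _]] inv_s] last_s.
case: (pi.-group _) => //= /andP[pi'LK fact_s] cnt0.
have nsLG : L <| G.
  by rewrite /normal -{1}last_s (invariant_series_sub_last inv_s).
by apply: quotient_pgroup_trans sKL pi'LK (IHs L _ _ _ _ _).
Qed.

Definition pi'pipi'_group G : Prop :=
  exists Q L, [/\ Q <| G, L <| G, Q \subset L, pi^'.-group Q
                & pi.-group (L / Q) /\ pi^'.-group (G / L)].

(** The factors before the first pi-factor merge into [Q], those after it into [G / L]. Separability
    is stated beside the bound because [pi_length] has the dummy value 0 on groups that are not
    pi-separable. *)
Lemma pi_length_le1P G :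
  (pi_separable pi G /\ pi_length pi G <= 1) <-> pi'pipi'_group G.
Proof.
split=> [[/pi_length_witness[s /and3P[inv_s /eqP last_s fact_s] <-]]|].
  rewrite /num_pi_factors; have: pi^'.-group (1%G : {group gT}) := pgroup1 _ _.
  have: 1%G <| G := normal1 G.
  (* The start [Q] of the remaining series ranges over normal pi'-subgroups of [G]; it grows until
     the first factor that is a pi-group. *)
  elim: s 1%G inv_s last_s fact_s => [|L s IHs] Q /=.
    move=> _ -> _ _ pi'G _; exists G, G; rewrite !normal_refl subxx.
    by rewrite trivg_quotient !pgroup1.
  move=> /andP[/and3P[_ nLG nsQL] inv_s] last_s /andP[piLQ fact_s] nsQG pi'Q.
  have nsLG : L <| G.
    by rewrite /normal -{1}last_s (invariant_series_sub_last inv_s).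
  case piLQ': (pi.-group _) piLQ => /= piLQ; last first.
    by rewrite add0n; apply: IHs => //; apply: pgroup_extension piLQ.
  rewrite -[X in _ <= X]addn0 leq_add2l leqn0 => /eqP cnt0.
  exists Q, L; split; rewrite ?normal_sub //; split=> //.
  exact: pi'_series_quotient cnt0.
case=> Q [L [nsQG nsLG sQL pi'Q [piLQ pi'GL]]].
(* A trivial factor counts as a pi-factor, so repeated terms must be dropped. *)
pose step (K H : {group gT}) := if H == K then [::] else [:: H].
pose s := step 1%G Q ++ step Q L ++ step L G.
suff [ser_s cnt_s]: pi_series pi G s /\ num_pi_factors pi s <= 1.
  by split; [exists s | apply: leq_trans (pi_length_le ser_s) cnt_s].
have nsQL : Q <| L := normalS sQL (normal_sub nsLG) nsQG.
have pi_eq (K H : {group gT}) : K <| H ->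
    pi^'.-group (H / K) -> pi.-group (H / K) = (H == K).
  move=> /andP[sKH nKH] pi'HK; apply/idP/eqP => [piHK|->]; last first.
    by rewrite trivg_quotient pgroup1.
  apply/val_inj/eqP; rewrite eqEsubset sKH andbT -quotient_sub1 //.
  by rewrite (pi_pi'_group1 piHK pi'HK).
have pi'Q1 : pi^'.-group (Q / 1%G) by apply: quotient_pgroup.
have [eqQ eqG] := (pi_eq _ _ (normal1 Q) pi'Q1, pi_eq _ _ nsLG pi'GL).
rewrite /s /step /pi_series /num_pi_factors /group_rel_of /invariant_factor.
case: (eqVneq Q 1%G) eqQ => [eQ1|nQ1] eqQ; case: (eqVneq L Q) => [eLQ|nLQ];
  case: (eqVneq G L) eqG => [eGL|nGL] eqG; subst;
  by rewrite /= ?nsQG ?nsLG ?nsQL ?norms1 ?normal1 ?normG ?normal_norm //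
             ?eqxx ?eqQ ?eqG ?piLQ ?pi'Q1 ?pi'GL.
Qed.

End PiLengthOne.

(** * Normal Hall subgroups, supplements and a Frattini argument *)

(** In C = C_G(F) the normal Hall subgroup [F :&: C] is central, so its Schur-Zassenhaus complement
    [Q] is normal in [C]. Then [Q] is characteristic in [C], lies in the trivial O_pi'(G), and C = F
    :&: C. *)
Lemma cent_normal_Hall_sub (pi : nat_pred) (gT : finGroupType)
    (G F : {group gT}) :
  F <| G -> pi.-Hall(G) F -> 'O_pi^'(G) = 1 -> 'C_G(F) \subset F.
Proof.
move=> nsFG hallF O1; have sFG := normal_sub nsFG.
pose C := 'C_G(F)%G; have sCG : C \subset G := subsetIl _ _.
have nsCG : C <| G.
  by rewrite /normal sCG normsI ?normG ?norms_cent ?normal_norm.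
have nFC := subset_trans sCG (normal_norm nsFG).
have nsZC : F :&: C <| C by rewrite /normal subsetIr normsI ?normG.
have hallZ := setI_normal_Hall nsFG hallF sCG.
have /splitsP[Q /complP[tiZQ defC]] :=
  SchurZassenhaus_split (pHall_Hall hallZ) nsZC.
have hallQ : pi^'.-Hall(C) Q by rewrite -(compl_pHall _ hallZ); apply/complP.
have sQC := pHall_sub hallQ.
have nsQC : Q <| C.
  rewrite /normal sQC -defC mul_subG ?normG // cents_norm // centsC.
  rewrite (subset_trans sQC) // subIset // orbC.
  by rewrite centS // subsetIl.
have Q1 : Q :=: 1.
  apply/trivgP; rewrite -O1 pcore_max ?(pHall_pgroup hallQ) //.
  rewrite -(normal_Hall_pcore hallQ nsQC).
  by rewrite (char_normal_trans (pcore_char _ _)).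
by move: defC; rewrite Q1 mulg1 => <-; apply: subsetIl.
Qed.

Lemma normal_Sylows_nilpotent (gT : finGroupType) (G : {group gT}) :
  (forall P : {group gT}, Sylow G P -> P <| G) -> nilpotent G.
Proof.
move=> nsSyl; rewrite -(_ : 'F(G) = G) ?Fitting_nil //.
apply/eqP; rewrite eqEsubset Fitting_sub /=.
rewrite -{1}[G : {set gT}]Sylow_gen gen_subG; apply/bigcupsP => P sylP.
case/SylowP: (sylP) => p _ /pHall_pgroup pP.
exact: Fitting_max (nsSyl _ sylP) (pgroup_nil pP).
Qed.

(** Take [K] minimal. For a Sylow subgroup [P] of [K :&: O], the Frattini argument makes ['N_K(P)] a
    supplement of [O] too, so it equals [K] by minimality and [P] is normal. *)
Lemma nilpotent_supplement (gT : finGroupType) (G O : {group gT}) :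
  O <| G -> exists K : {group gT}, O * K = G /\ nilpotent (K :&: O).
Proof.
move=> /andP[sOG nOG].
have: [pred K : {group gT} | O * K == G] G by rewrite /= mulSGid.
case/mingroup_exists=> K /mingroupP[/= /eqP defG minK] _; exists K; split=> //.
have sKG : K \subset G by rewrite -defG mulG_subr.
have nKO : K \subset 'N(K :&: O) by rewrite normsI ?normG ?(subset_trans sKG).
apply: normal_Sylows_nilpotent => P /SylowP[p _ sylP].
have defK := Frattini_arg (introT andP (conj (subsetIl K O) nKO)) sylP.
have NK : 'N_K(P) = K.
  apply: (minK 'N_K(P)%G _ (subsetIl _ _)).
  rewrite -[in X in _ == X]defG -[in X in _ == X]defK mulgA.
  by rewrite (mulGSid (subsetIr K O)).
have nPK : K \subset 'N(P) by rewrite -{1}NK subsetIr.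
by rewrite /normal (pHall_sub sylP) (subset_trans (subsetIl K O)).
Qed.

(* The conjugacy part of Schur-Zassenhaus is available for a solvable normal
   subgroup only; a supplement K of O with K :&: O nilpotent avoids the need for
   solvability of O or L / O. *)
Lemma normal_Hall_Frattini (pi : nat_pred) (gT : finGroupType)
    (G L O : {group gT}) :
    O <| G -> L <| G -> O \subset L -> pi^'.-group O -> pi.-group (L / O) ->
  exists H : {group gT}, [/\ pi.-group H, O * H = L & O * 'N_G(H) = G].
Proof.
move=> nsOG nsLG sOL pi'O piLO; have [sOG nOG] := andP nsOG.
have [K [defG nilM]] := nilpotent_supplement nsOG.
have sKG : K \subset G by rewrite -defG mulG_subr.
have [sLG nLG] := andP nsLG.
pose L1 := (K :&: L)%G.
have sL1L : L1 \subset L := subsetIr _ _.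
have defL : O * L1 = L by rewrite /= group_modl // defG (setIidPr sLG).
have nOL1 : L1 \subset 'N(O) := subset_trans sL1L (subset_trans sLG nOG).
have nsML1 : K :&: O <| L1.
  by rewrite /normal setIS // normsI // (subset_trans (subsetIl K L)) ?normG.
have hallM : pi^'.-Hall(L1) (K :&: O).
  rewrite /pHall normal_sub // (pgroupS (subsetIr K O)) //=.
  have -> : K :&: O = L1 :&: O by rewrite /= -setIA (setIidPr sOL).
  rewrite indexgI -card_quotient // pnatNK.
  by apply: pgroupS (quotientS _ sL1L) piLO.
have /splitsP[H /complP[tiMH defL1]] :=
  SchurZassenhaus_split (pHall_Hall hallM) nsML1.
have hallH : pi^'^'.-Hall(L1) H by rewrite -(compl_pHall _ hallM); apply/complP.
have piH : pi.-group H by rewrite -pgroupNK (pHall_pgroup hallH).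
exists H; split=> //.
  by rewrite -defL -defL1 mulgA (mulGSid (subsetIr K O)).
apply/eqP; rewrite eqEsubset mul_subG ?subsetIl //=.
suff sKN : K \subset O * 'N_G(H).
  by rewrite -{1}defG (subset_trans (mulgS O sKN)) // mulgA mulGid.
have sHL1 := pHall_sub hallH.
have nMH : H \subset 'N(K :&: O) := subset_trans sHL1 (normal_norm nsML1).
(* [H :^ x] is again a complement of the nilpotent group [K :&: O] in [L1], hence equals [H :^ y]
   with [y] in [K :&: O]; so [x * y^-1] normalises [H]. *)
apply/subsetP => x Kx.
have nL1K : K \subset 'N(L1) by rewrite normsI ?normG ?(subset_trans sKG).
have sHx : H :^ x \subset (K :&: O) * H.
  by rewrite defL1 -(normsP nL1K x Kx) conjSg.
have coMH : coprime #|K :&: O| #|H|.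
  rewrite coprime_sym (pnat_coprime piH) //.
  by apply: pgroupS pi'O; apply: subsetIr.
have [y /setIP[Ky Oy] defHx] :=
  SchurZassenhaus_trans_sol (nilpotent_sol nilM) nMH sHx coMH (cardJg _ _).
rewrite -(normC (subset_trans (subsetIl G _) nOG)) -(mulgKV y x) mem_mulg //.
rewrite inE groupM ?groupV ?(subsetP sKG) //=; apply/normP.
by rewrite conjsgM defHx conjsgK.
Qed.

(** * Membership in sigma(n) and {sigma_i}-nilpotent groups *)

Lemma in_sigma_dvd (I : Type) (sigma : I -> nat_pred) m n i :
  m %| n -> 0 < n -> in_sigma sigma m i -> in_sigma sigma n i.
Proof.
move=> dv_mn n_gt0 [p + sig_p]; rewrite mem_primes => /and3P[pr_p _ dv_pm].
by exists p; rewrite // mem_primes pr_p n_gt0 (dvdn_trans dv_pm).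
Qed.

Lemma in_sigmaPn (I : Type) (sigma : I -> nat_pred) (gT : finGroupType)
    (G : {group gT}) i :
  ~ in_sigma sigma #|G| i <-> (sigma i)^'.-group G.
Proof.
split=> [notG|/pgroupP p'G [p]]; first exact: not_in_sigma.
by rewrite mem_primes => /and3P[pr_p _ /(p'G p pr_p)/negP].
Qed.

Section Sigma.

Variables (I : Type) (sigma : I -> nat_pred).
Hypothesis sigmaP : prime_partition sigma.

Lemma sigma_pi'_group (gT : finGroupType) i j (G : {group gT}) :
  i <> j -> (sigma j).-group G -> (sigma i)^'.-group G.
Proof.
move=> neq_ij; apply: sub_pgroup => p sig_p; have [_ _ tI] := sigmaP.
by rewrite inE /=; apply: tI sig_p => eq_ji; apply: neq_ij.
Qed.

Section OneGroup.

Variable gT : finGroupType.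
Implicit Types (i j k : I) (A G H K L N O P Q : {group gT}).

Lemma sigma1_nilpotentI i G Q :
    Q <| G -> (sigma i)^'.-group Q -> (sigma i).-group (G / Q) ->
  sigma1_nilpotent sigma i G.
Proof.
move=> nsQG p'Q piGQ; apply/(sigma1_nilpotentE sigmaP).
by apply: pgroup_quotientS piGQ; rewrite ?pcore_normal ?pcore_max.
Qed.

Lemma sigma1_nilpotentP i G :
  sigma1_nilpotent sigma i G <-> (sigma i)^'.-Hall(G) 'O_(sigma i)^'(G).
Proof.
rewrite (sigma1_nilpotentE sigmaP) /pHall pcore_sub pcore_pgroup /= pnatNK.
by rewrite /pgroup card_quotient ?normal_norm ?pcore_normal.
Qed.

Lemma pgroup_sigma1_nilpotent i G :
  (sigma i).-group G -> sigma1_nilpotent sigma i G.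
Proof.
move=> piG; apply: (sigma1_nilpotentI (normal1 G)) (pgroup1 _ _) _.
exact: quotient_pgroup.
Qed.

Lemma pi'group_sigma1_nilpotent i G :
  (sigma i)^'.-group G -> sigma1_nilpotent sigma i G.
Proof.
move=> p'G; apply: (sigma1_nilpotentI (normal_refl G)) p'G _.
by rewrite trivg_quotient pgroup1.
Qed.

Lemma sigma1_nilpotentS i G H :
  H \subset G -> sigma1_nilpotent sigma i G -> sigma1_nilpotent sigma i H.
Proof.
move=> sHG /sigma1_nilpotentP hallO; apply/sigma1_nilpotentP.
have nsOG := pcore_normal (sigma i)^' G.
have hallOH := setI_normal_Hall nsOG hallO sHG.
rewrite (normal_Hall_pcore hallOH) //.
by rewrite /normal subsetIr normsI ?normG ?(subset_trans sHG) ?normal_norm.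
Qed.

(** A chief factor is nontrivial, so some prime divides its order; the class of that prime supplies
    the index at which to apply the right-hand side. *)
Lemma sigma_nilpotentP G :
  sigma_nilpotent sigma G <-> forall i, sigma1_nilpotent sigma i G.
Proof.
split=> [nilG i H K chHK _|nilG H K chHK]; first exact: nilG.
have /andP[/maxgroupp/andP[prKH nKG] /andP[sHG _]] := chHK.
have ntHK : H / K != 1.
  rewrite -subG1 quotient_sub1 ?(subset_trans sHG nKG) //.
  exact: proper_subn prKH.
have [_ coverP _] := sigmaP.
have pr_p : prime (pdiv #|H / K|) by rewrite pdiv_prime // cardG_gt1.
have [i sig_p] := coverP _ pr_p; apply: (nilG i) => //.
by exists (pdiv #|H / K|); rewrite // pi_pdiv cardG_gt1.
Qed.

Lemma Nsigma_critical_exists G :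
  ~ sigma_nilpotent sigma G ->
  exists2 H : {group gT}, H \subset G & Nsigma_critical sigma H.
Proof.
move=> nnilG.
have: [pred H : {group gT} | ~~ `[< sigma_nilpotent sigma H >]] G.
  by apply/asboolPn.
case/mingroup_exists=> H /mingroupP[/= /asboolPn nnilH minH] sHG.
exists H => //; split=> // K prKH; apply: contrapT => nnilK.
have [sKH /negP[]] := andP prKH.
by rewrite -(minH K) //; apply/asboolPn.
Qed.

(** * The subgroup F_{sigma_i}(G) and the second inclusion *)

Lemma sigma1_Fitting_normal i G : sigma1_Fitting sigma i G <| G.
Proof. by have [] := sigma1_FittingP sigmaP i G. Qed.

Lemma sigma1_Fitting_nil i G :
  sigma1_nilpotent sigma i (sigma1_Fitting sigma i G).
Proof. by have [] := sigma1_FittingP sigmaP i G. Qed.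

Lemma sigma1_Fitting_max i G N :
  N <| G -> sigma1_nilpotent sigma i N -> N \subset sigma1_Fitting sigma i G.
Proof. by have [_ _] := sigma1_FittingP sigmaP i G; apply. Qed.

Lemma sigma1_Fitting_id i G :
  sigma1_nilpotent sigma i G -> sigma1_Fitting sigma i G :=: G.
Proof.
move=> nilG; apply/eqP; rewrite eqEsubset normal_sub ?sigma1_Fitting_normal //.
by rewrite sigma1_Fitting_max ?normal_refl.
Qed.

(** Since {sigma_i}-nilpotence passes to subgroups, H :&: F(G) lies in F(H); hence |H : F(H)|
    divides |H : H :&: F(G)| = |H F(G) : F(G)|. *)
Lemma sigma1_Fitting_quotient_dvd i G H :
  H \subset G ->
  #|H / sigma1_Fitting sigma i H| %| #|G / sigma1_Fitting sigma i G|.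
Proof.
move=> sHG; have nsFG := sigma1_Fitting_normal i G.
have nsFH := sigma1_Fitting_normal i H.
have [sFG nFG] := andP nsFG.
rewrite !card_quotient ?(normal_norm nsFH) //.
have nFH := subset_trans sHG nFG.
apply: (@dvdn_trans #|H : sigma1_Fitting sigma i G|).
  rewrite -[X in _ %| X]indexgI indexgS // sigma1_Fitting_max //.
    by rewrite /normal subsetIl normsI ?normG.
  exact: sigma1_nilpotentS (subsetIr H _) (@sigma1_Fitting_nil i G).
rewrite -indexMg -norm_joinEr // indexSg ?joing_subl //.
by rewrite join_subG sFG.
Qed.

Lemma VM_sub_Hawkes G :
  subgraph (sigma_VM_graph sigma G) (sigma_Hawkes_graph sigma G).
Proof.
split=> // i j [inGi inGj [H [sHG _ _ inHj]]]; split=> //.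
by apply: in_sigma_dvd inHj; rewrite ?sigma1_Fitting_quotient_dvd.
Qed.

Lemma VM_graphS G H i j :
  H \subset G -> edge (sigma_VM_graph sigma H) i j ->
  edge (sigma_VM_graph sigma G) i j.
Proof.
move=> sHG [inHi inHj [K [sKH critK inKi inKj]]].
have up k : in_sigma sigma #|H| k -> in_sigma sigma #|G| k.
  by apply: in_sigma_dvd; rewrite ?cardSg.
by split; [apply: up|apply: up|exists K; split=> //; apply: subset_trans sHG].
Qed.

(** * Critical subgroups from noncentral actions, and the first inclusion *)

(** Only the index [i] carries information: at [j] the subgroup [A] is a normal sigma_j'-subgroup
    with sigma_j-quotient, and at any other [k] the group is a sigma_k'-group. *)
Lemma biprimary_sigma_nilpotent i j G A :
    i <> j -> A <| G -> (sigma i).-group A -> (sigma j).-group (G / A) ->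
  sigma1_nilpotent sigma i G -> sigma_nilpotent sigma G.
Proof.
move=> neq_ij nsAG piA pjGA nilG; apply/sigma_nilpotentP => k.
have [<-//|neq_ki] := pselect (i = k).
have pk'A : (sigma k)^'.-group A.
  by apply: (sigma_pi'_group _ piA) => eq_ki; apply: neq_ki.
have [<-|neq_jk] := pselect (j = k).
  apply: (sigma1_nilpotentI nsAG) pjGA.
  by apply: (sigma_pi'_group _ piA) => /esym.
apply: pi'group_sigma1_nilpotent; apply: pgroup_extension nsAG pk'A _.
by apply: (sigma_pi'_group _ pjGA) => /esym.
Qed.

(** If A P were {sigma_i}-nilpotent, [P] would lie in O_{sigma_i'}(A P) and [A, P] in its trivial
    intersection with [A]. So A P has a critical subgroup [S], which inherits the shape of a
    sigma_i-group extended by a sigma_j-group. *)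
Lemma noncentralizing_VM_edge i j G A P :
    A \subset G -> P \subset G -> i <> j ->
    (sigma i).-group A -> (sigma j).-group P ->
    P \subset 'N(A) -> ~~ (P \subset 'C(A)) ->
  edge (sigma_VM_graph sigma G) i j.
Proof.
move=> sAG sPG neq_ij piA pjP nAP ncAP; pose K := (A <*> P)%G.
have sAK : A \subset K := joing_subl A P.
have sPK : P \subset K := joing_subr A P.
have nsAK : A <| K by rewrite /normal sAK join_subG normG.
have piP := sigma_pi'_group neq_ij pjP.
have pjKA : (sigma j).-group (K / A).
  by rewrite /= quotientYidl // quotient_pgroup.
have nnilK : ~ sigma_nilpotent sigma K.
  move=> /sigma_nilpotentP/(_ i)/sigma1_nilpotentP hallO; case/negP: ncAP.
  have nsOK := pcore_normal (sigma i)^' K.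
  have sPO : P \subset 'O_(sigma i)^'(K) by rewrite (sub_normal_Hall hallO).
  rewrite centsC; apply/commG1P/trivgP.
  rewrite -(coprime_TIg (pnat_coprime piA (pcore_pgroup (sigma i)^' K))).
  rewrite subsetI commg_subl nAP /=.
  apply: subset_trans (commgS A sPO) _; rewrite commg_subr.
  exact: subset_trans sAK (normal_norm nsOK).
have [S sSK critS] := Nsigma_critical_exists nnilK; have [nnilS _] := critS.
have nAS : S \subset 'N(A) := subset_trans sSK (normal_norm nsAK).
pose B := (S :&: A)%G.
have nsBS : B <| S by rewrite /normal subsetIl normsI ?normG.
have piB : (sigma i).-group B := pgroupS (subsetIr S A) piA.
have pjSB : (sigma j).-group (S / B).
  rewrite /pgroup card_quotient ?normal_norm //= indexgI -card_quotient //.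
  exact: pgroupS (quotientS A sSK) pjKA.
have nnil1S : ~ sigma1_nilpotent sigma i S.
  by move/(biprimary_sigma_nilpotent neq_ij nsBS piB pjSB).
have inSi : in_sigma sigma #|S| i.
  by apply: contrapT => /in_sigmaPn /pi'group_sigma1_nilpotent.
(* F(S) contains [B], so S / F(S) is a sigma_j-group; were it also a sigma_j'-group, [S] would equal
   F(S) and be {sigma_i}-nilpotent. *)
have inSj : in_sigma sigma #|S / sigma1_Fitting sigma i S| j.
  apply: contrapT => /in_sigmaPn pj'SF; apply: nnil1S.
  have nsFS := sigma1_Fitting_normal i S.
  have sBF : B \subset sigma1_Fitting sigma i S.
    by apply: sigma1_Fitting_max nsBS _; apply: pgroup_sigma1_nilpotent.
  have := pi_pi'_group1 (pgroup_quotientS nsBS nsFS sBF pjSB) pj'SF.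
  move/trivgP; rewrite quotient_sub1 ?normal_norm // => sSF.
  exact: sigma1_nilpotentS sSF (@sigma1_Fitting_nil i S).
apply: (@VM_graphS G S); first by rewrite (subset_trans sSK) // join_subG sAG.
split=> //; last by exists S.
by apply: in_sigma_dvd inSj; rewrite ?dvdn_quotient.
Qed.

Lemma card_normalizer_quotient G H :
  #|'N_G(H) / (H <*> 'C_G(H))| = #|'N_G(H) : H <*> 'C_G(H)|.
Proof.
rewrite card_quotient // normsY ?subsetIr // normsI //.
  by rewrite subIset // normG.
by apply: norms_cent; apply: subsetIr.
Qed.

(** |N_G(H) : H C_G(H)| divides |G : H|, a sigma_i'-number. *)
Lemma Hall_edge_neq i j G :
  edge (sigma_Hall_graph sigma G) i j -> i <> j.
Proof.
case=> _ _ [H /and3P[sHG _ pi'GH] inj] eq_ij.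
have sHN : H \subset 'N_G(H) by rewrite subsetI sHG normG.
suff /in_sigmaPn[] : (sigma i)^'.-group ('N_G(H) / (H <*> 'C_G(H))).
  by rewrite eq_ij.
rewrite /pgroup card_normalizer_quotient.
apply: (pnat_dvd _ pi'GH); apply: (@dvdn_trans #|'N_G(H) : H|).
  by rewrite indexgS ?joing_subl.
by rewrite indexSg ?subsetIl.
Qed.

(** For a prime p of sigma_j dividing |N_G(H) : H C_G(H)|, a Sylow p-subgroup of N_G(H) cannot
    centralise [H]: it would lie in H C_G(H) and make that index prime to p. *)
Lemma Hall_sub_VM G :
  subgraph (sigma_Hall_graph sigma G) (sigma_VM_graph sigma G).
Proof.
split=> // i j ed; have neq_ij := Hall_edge_neq ed.
case: ed => _ _ [H hallH [p]]; rewrite mem_primes => /and3P[pr_p _ dv_p] sig_p.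
have [P sylP] := Sylow_exists p 'N_G(H).
have [sPN pP _] := and3P sylP; have [sPG nHP] := subsetIP sPN.
have [sHG piH _] := and3P hallH.
apply: (noncentralizing_VM_edge sHG sPG neq_ij piH _ nHP).
  by apply: sub_pgroup pP => q /eqP->.
apply/negP => cHP.
have sPHC : P \subset H <*> 'C_G(H).
  by rewrite (subset_trans _ (joing_subr _ _)) // subsetI sPG.
have: p^'.-nat #|'N_G(H) : H <*> 'C_G(H)|.
  by apply: (pnat_dvd (indexgS _ sPHC)); case/and3P: sylP.
rewrite -card_normalizer_quotient => /pnatP/(_ p); rewrite inE /= inE eqxx.
by move/(_ (cardG_gt0 _) pr_p dv_p).
Qed.

(** A solvable critical [H] has a normal {sigma_i}-nilpotent subgroup [M] of prime index q. If q is
    outside sigma_i, then [M] lies in F(H) and H / F(H) is a sigma_i'-group; otherwise H /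
    O_{sigma_i'}(M) is a sigma_i-group and H = F(H). *)
Lemma VM_loopless G : solvable G -> loopless (sigma_VM_graph sigma G).
Proof.
move=> solG i [_ _ [H [sHG [nnilH nilH] _]]]; apply/in_sigmaPn.
have ntH : H :!=: 1.
  apply/eqP => H1; apply: nnilH; apply/sigma_nilpotentP => k.
  by apply: pgroup_sigma1_nilpotent; rewrite H1 pgroup1.
have [M nsMH pr_q] := sol_prime_factor_exists (solvableS sHG solG) ntH.
have [sMH nMH] := andP nsMH.
have prMH : M \proper H.
  by rewrite properE sMH -indexg_eq1 neq_ltn prime_gt1 ?orbT.
have nilM : sigma1_nilpotent sigma i M.
  by have /sigma_nilpotentP := nilH _ prMH; apply.
have [sig_q|nsig_q] := boolP (#|H : M| \in sigma i); last first.
  have sMF := sigma1_Fitting_max nsMH nilM.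
  apply: (pgroup_quotientS nsMH (sigma1_Fitting_normal i H) sMF).
  by rewrite /pgroup card_quotient // pnatE.
suff nilHi : sigma1_nilpotent sigma i H.
  by rewrite sigma1_Fitting_id //= trivg_quotient pgroup1.
have nsOH : 'O_(sigma i)^'(M) <| H.
  exact: char_normal_trans (pcore_char _ _) nsMH.
apply: (@sigma1_nilpotentI i H _ nsOH (pcore_pgroup _ _)).
apply: (quotient_pgroup_trans nsOH nsMH (pcore_sub _ _)).
  by apply/(sigma1_nilpotentE sigmaP).
by rewrite /pgroup card_quotient // pnatE.
Qed.

(** * Loops of the Hawkes graph and the reverse inclusion *)

Lemma Hawkes_no_loopP i G :
  ~ edge (sigma_Hawkes_graph sigma G) i i <->
  (sigma i)^'.-group (G / sigma1_Fitting sigma i G).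
Proof.
split=> [noloop|/in_sigmaPn noloop []//].
apply/in_sigmaPn => inF; apply: noloop.
by split=> //; apply: in_sigma_dvd inF; rewrite ?dvdn_quotient.
Qed.

(** O_{sigma_i'}(F) is characteristic in [F], so it lies in O_{sigma_i'}(G), and [F / O] is an image
    of the sigma_i-group F / O_{sigma_i'}(F). *)
Lemma sigma1_Fitting_pcore i G :
  'O_(sigma i)^'(G) \subset sigma1_Fitting sigma i G /\
  (sigma i).-group (sigma1_Fitting sigma i G / 'O_(sigma i)^'(G)).
Proof.
set F := sigma1_Fitting sigma i G; set O := 'O_(sigma i)^'(G).
have nsFG : F <| G := sigma1_Fitting_normal i G.
have sOF : O \subset F.
  apply: sigma1_Fitting_max (pcore_normal _ _) _.
  exact: pi'group_sigma1_nilpotent (pcore_pgroup _ _).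
split=> //; have nilF := @sigma1_Fitting_nil i G.
have nsOF : O <| F := normalS sOF (normal_sub nsFG) (pcore_normal _ _).
apply: (pgroup_quotientS (pcore_normal (sigma i)^' F) nsOF).
  apply: pcore_max; first exact: pcore_pgroup.
  exact: char_normal_trans (pcore_char _ _) nsFG.
exact/(sigma1_nilpotentE sigmaP).
Qed.

(** The middle term [L] of such a series is {sigma_i}-nilpotent, so it lies in F(G) and G / F(G) is
    an image of [G / L]. *)
Lemma Fitting_pi'pipi' i G :
  (sigma i)^'.-group (G / sigma1_Fitting sigma i G) <->
  pi'pipi'_group (sigma i) G.
Proof.
split=> [pi'GF|[Q [L [nsQG nsLG sQL pi'Q [piLQ pi'GL]]]]].
  have [sOF piFO] := sigma1_Fitting_pcore i G.
  exists 'O_(sigma i)^'(G)%G, (sigma1_Fitting sigma i G).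
  by rewrite pcore_normal sigma1_Fitting_normal pcore_pgroup.
apply: pgroup_quotientS pi'GL; rewrite ?sigma1_Fitting_normal //.
apply: sigma1_Fitting_max => //.
apply: (@sigma1_nilpotentI i L Q) => //.
exact: normalS sQL (normal_sub nsLG) nsQG.
Qed.

(** The hypothesis is local: a missing loop at [i] governs all edges that leave [i]. *)
Lemma Hawkes_sub_Hall G i j :
    ~ edge (sigma_Hawkes_graph sigma G) i i ->
    edge (sigma_Hawkes_graph sigma G) i j ->
  edge (sigma_Hall_graph sigma G) i j.
Proof.
move=> /Hawkes_no_loopP pi'GF [inGi inGj inFj]; split=> //.
have [sOF piFO] := sigma1_Fitting_pcore i G.
have nsFG := sigma1_Fitting_normal i G.
set F := sigma1_Fitting sigma i G in pi'GF inFj sOF piFO nsFG *.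
pose O := 'O_(sigma i)^'(G)%G; have nsOG : O <| G := pcore_normal _ _.
have [H [piH defF defG]] :=
  normal_Hall_Frattini nsOG nsFG sOF (pcore_pgroup _ _) piFO.
have [[sFG nFG] [sOG nOG]] := (andP nsFG, andP nsOG).
have sHF : H \subset F by rewrite -defF mulG_subr.
have sHG := subset_trans sHF sFG; have nOH := subset_trans sHG nOG.
(* |G : F| is a sigma_i'-number as there is no loop, and |F : H| divides |O| since F = O H. *)
have hallH : (sigma i).-Hall(G) H.
  rewrite /pHall sHG piH -(Lagrange_index sFG sHF) pnatM.
  rewrite -(card_quotient nFG) (pi'GF : _.-nat _).
  have iFH : #|F : H| %| #|O|.
    rewrite -(@dvdn_pmul2l #|H|) // Lagrange // -defF [X in _ %| X]mulnC.
    by rewrite mul_cardG dvdn_mulr.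
  exact: pnat_dvd iFH (pcore_pgroup (sigma i)^' G).
exists H => //.
(* Modulo [O], the image of ['C_G(H)] centralises H O / O = F / O, a normal Hall sigma_i-subgroup
   that contains its centraliser because O_{sigma_i'}(G / O) = 1. *)
have sCF : 'C_G(H) \subset F.
  have hallFO : (sigma i).-Hall(G / O) (F / O).
    rewrite /pHall quotientS // piFO -card_quotient ?quotient_norms //.
    rewrite (card_isog (third_isog sOF nsOG nsFG)).
    exact: pi'GF.
  rewrite -(quotientSGK _ sOF) ?(subset_trans (subsetIl G _)) //.
  have := cent_normal_Hall_sub (quotient_normal O nsFG) hallFO
    (trivg_pcore_quotient _ _).
  apply: subset_trans; rewrite subsetI quotientS ?subsetIl //=.
  rewrite -defF quotientMidl; apply: subset_trans (quotient_cent _ _).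
  by rewrite quotientS ?subsetIr.
apply: in_sigma_dvd inFj => //.
rewrite card_normalizer_quotient card_quotient //.
have sNG : 'N_G(H) \subset G := subsetIl _ _.
(* Hence |G : F| = |N_G(H) : N_G(H) :&: F|, which divides |N_G(H) : H C_G(H)|. *)
have defFN : F * 'N_G(H) = G.
  by apply/eqP; rewrite eqEsubset mul_subG //= -{1}defG mulSg.
have sHCN : H <*> 'C_G(H) \subset 'N_G(H) :&: F.
  rewrite subsetI !join_subG sHF sCF !subsetI sHG normG subsetIl /=.
  by rewrite (subset_trans (subsetIr _ _)) ?cent_sub.
rewrite -[X in #|X : F| %| _]defFN indexMg -(indexgI _ F).
exact: indexgS.
Qed.

End OneGroup.
End Sigma.

(** * Equality of graphs, sigma-solubility and the pi-length criterion *)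

Lemma subgraph_anti (V : Type) (A B : digraph V) :
  subgraph A B -> subgraph B A -> A = B.
Proof.
case: A B => [vA eA] [vB eB] [/= sv se] [/= sv' se'].
congr Digraph; apply/funext => x.
  by apply/propext; split; [apply: sv | apply: sv'].
by apply/funext => y; apply/propext; split; [apply: se | apply: se'].
Qed.

Section SigmaGraphs.

Variables (I : Type) (sigma : I -> nat_pred).
Hypothesis sigmaP : prime_partition sigma.
Variable gT : finGroupType.
Implicit Types (i : I) (G H K : {group gT}).

Lemma chief_series_pi_series (pi : nat_pred) G :
  (forall H K, chief_factor G K H ->
     pi.-group (H / K) || pi^'.-group (H / K)) ->
  pi_separable pi G.
Proof.
move=> chG; have [s chs last_s] := chief_series_exists (normal_refl G).
exists s; rewrite /pi_series last_s eqxx /=; apply/andP; split.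
  apply: sub_path chs => K H /= /andP[/maxgroupp/andP[prKH nKG] /andP[sHG nHG]].
  by rewrite /invariant_factor nKG nHG /normal proper_sub // (subset_trans sHG).
by apply: sub_path chs => K H /=; apply: chG.
Qed.

Lemma sigma_soluble_pi_separable i G :
  sigma_soluble sigma G -> pi_separable (sigma i) G.
Proof.
move=> solG; apply: chief_series_pi_series => H K /solG[j pjHK].
have [<-|neq_ij] := pselect (j = i); first by rewrite pjHK.
by rewrite (sigma_pi'_group sigmaP _ pjHK) ?orbT // => /esym.
Qed.

(** Choose [i] as the class of a prime dividing |H / K|: separability leaves a sigma_i- or
    sigma_i'-group, and that prime excludes the latter. *)
Lemma pi_separable_sigma_soluble G :
  (forall i, pi_separable (sigma i) G) -> sigma_soluble sigma G.
Proof.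
move=> sepG H K chHK.
have /andP[/maxgroupp/andP[prKH nKG] /andP[sHG _]] := chHK.
have gt1HK : 1 < #|H / K|.
  rewrite cardG_gt1 -subG1 quotient_sub1 ?(subset_trans sHG nKG) //.
  exact: proper_subn prKH.
have pr_p := pdiv_prime gt1HK; have [_ /(_ _ pr_p)[i sig_p] _] := sigmaP.
exists i; have [s ser_s] := sepG i.
case/orP: (pi_series_chief_factor ser_s chHK) => // /pgroupP/(_ _ pr_p).
by rewrite pdiv_dvd => /(_ isT); rewrite inE /= sig_p.
Qed.

Lemma loopless_HawkesP G :
  loopless (sigma_Hawkes_graph sigma G) <->
  sigma_soluble sigma G
  /\ (forall i, in_sigma sigma #|G| i -> pi_length (sigma i) G <= 1).
Proof.
have no_loopP i : ~ edge (sigma_Hawkes_graph sigma G) i i <->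
    (pi_separable (sigma i) G /\ pi_length (sigma i) G <= 1).
  by rewrite Hawkes_no_loopP (Fitting_pi'pipi' sigmaP) -pi_length_le1P.
split=> [noloop|[solG len1] i].
  (* Indices outside sigma(G) are included, as no edge exists there; thus [G] is separable for every
     class. *)
  have lenG i := (no_loopP i).1 (noloop i).
  split=> [|i _]; last by have [] := lenG i.
  by apply: pi_separable_sigma_soluble => i; have [] := lenG i.
(* A loop places [i] in sigma(G), where the length bound is available. *)
move=> loop; have [inGi _ _] := loop; move: loop; apply/no_loopP.
by split; [apply: sigma_soluble_pi_separable | apply: len1].
Qed.

Lemma eq_graphs_loopless G :
  (sigma_Hall_graph sigma G = sigma_VM_graph sigma G
   /\ sigma_VM_graph sigma G = sigma_Hawkes_graph sigma G)
  <-> loopless (sigma_Hawkes_graph sigma G).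
Proof.
split=> [[<- <-] i loop_i|noloop]; first exact: (Hall_edge_neq loop_i).

have sub1 := Hall_sub_VM sigmaP G; have sub2 := VM_sub_Hawkes sigmaP G.
have sub3 : subgraph (sigma_Hawkes_graph sigma G) (sigma_Hall_graph sigma G).
  by split=> // i j; apply: (Hawkes_sub_Hall sigmaP (noloop i)).
split; apply: subgraph_anti => //; split=> // i j.
  by move/sub2.2/sub3.2.
by move/sub3.2/sub1.2.
Qed.

End SigmaGraphs.

(** * Strictness of both inclusions for Sym(4) *)

Section SymmetricGroup4.

(** On Sym(4), of order 24, it separates just the primes 2 (index [true]) and 3 (index [false]). *)
Definition parity_partition (b : bool) : nat_pred :=
  [pred p | prime p && ((p == 2) == b)].

Lemma parity_partitionP : prime_partition parity_partition.
Proof.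
split=> [i p|p pr_p|i j p neq_ij]; first by rewrite inE => /andP[].
  by exists (p == 2); rewrite inE /= pr_p eqxx.
by rewrite !inE /= => /andP[pr_p /eqP eqi]; rewrite pr_p eqi; apply/eqP.
Qed.

Lemma parity_cycle (gT : finGroupType) (x : gT) p b :
  prime p -> (p == 2) = b -> x ^+ p = 1 -> (parity_partition b).-group <[x]>.
Proof.
move=> pr_p eq_b /eqP; rewrite -order_dvdn => dv_xp.
by rewrite /pgroup -/#[x] (pnat_dvd dv_xp) // pnatE // inE /= pr_p eq_b eqxx.
Qed.

Lemma quotient_pi'group_sub (pi : nat_pred) (gT : finGroupType)
    (G N A : {group gT}) :
  N <| G -> pi^'.-group (G / N) -> A \subset G -> pi.-group A -> A \subset N.
Proof.
move=> nsNG pi'GN sAG piA; have nNA := subset_trans sAG (normal_norm nsNG).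
rewrite -quotient_sub1 // (pi_pi'_group1 (quotient_pgroup N piA)) //.
exact: pgroupS (quotientS N sAG) pi'GN.
Qed.

Notation S4 := [set: {perm 'I_4}]%G.
Let p0 : 'I_4 := @Ordinal 4 0 isT.
Let p1 : 'I_4 := @Ordinal 4 1 isT.
Let p2 : 'I_4 := @Ordinal 4 2 isT.
Let p3 : 'I_4 := @Ordinal 4 3 isT.
Let s := tperm p0 p1.
Let t := tperm p1 p2.
Let u := tperm p2 p3.

Let S4_ext (f g : {perm 'I_4}) :
  f p0 = g p0 -> f p1 = g p1 -> f p2 = g p2 -> f p3 = g p3 -> f = g.
Proof.
move=> e0 e1 e2 e3; apply/permP; case=> [[|[|[|[|//]]]] lt4].
- by rewrite (_ : Ordinal lt4 = p0) //; apply: val_inj.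
- by rewrite (_ : Ordinal lt4 = p1) //; apply: val_inj.
- by rewrite (_ : Ordinal lt4 = p2) //; apply: val_inj.
- by rewrite (_ : Ordinal lt4 = p3) //; apply: val_inj.
Qed.

Local Ltac compute_perm :=
  apply: S4_ext; rewrite /s /t /u /tperm !(permM, perm1, permE).

Let s2 : s ^+ 2 = 1. Proof. by rewrite expgS expg1 tperm2. Qed.
Let t2 : t ^+ 2 = 1. Proof. by rewrite expgS expg1 tperm2. Qed.
Let u2 : u ^+ 2 = 1. Proof. by rewrite expgS expg1 tperm2. Qed.

Let st3 : (s * t) ^+ 3 = 1.
Proof. by rewrite !expgS expg0; compute_perm. Qed.

Let tu3 : (t * u) ^+ 3 = 1.
Proof. by rewrite !expgS expg0; compute_perm. Qed.

Let st_neq1 : s * t != 1.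
Proof.
by apply/eqP=> /permP/(_ p0); rewrite /s /t /tperm !(permM, perm1, permE).
Qed.

(** [a] and [b] generate the normal Klein four-group, whose involutions the 3-cycle [s * t] permutes
    cyclically. *)
Let a := s * u.
Let b := tperm p0 p2 * tperm p1 p3.

Let a2 : a ^+ 2 = 1.
Proof. by rewrite expgS expg1 /a; compute_perm. Qed.

Let b2 : b ^+ 2 = 1.
Proof. by rewrite expgS expg1 /b; compute_perm. Qed.

Let cab : commute a b.
Proof. by rewrite /commute /a /b; compute_perm. Qed.

Let a_neq1 : a != 1.
Proof.
by apply/eqP=> /permP/(_ p0); rewrite /a /s /u /tperm !(permM, perm1, permE).
Qed.

Let a_neq_b : a != b.
Proof.
by apply/eqP=> /permP/(_ p0); rewrite /a /b /s /u /tperm !(permM, perm1, permE).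
Qed.

Let conj_a : a ^ (s * t) = b.
Proof.
rewrite conjgE; apply: (canLR (mulKg _)).
by rewrite /a /b; compute_perm.
Qed.

Let conj_b : b ^ (s * t) = a * b.
Proof.
rewrite conjgE; apply: (canLR (mulKg _)).
by rewrite /a /b; compute_perm.
Qed.

Let group2 (x : {perm 'I_4}) :
  x ^+ 2 = 1 -> (parity_partition true).-group <[x]>.
Proof. exact: parity_cycle. Qed.

Let group3 (x : {perm 'I_4}) :
  x ^+ 3 = 1 -> (parity_partition false).-group <[x]>.
Proof. exact: parity_cycle. Qed.

Let group3' (x : {perm 'I_4}) :
  x ^+ 3 = 1 -> (parity_partition true)^'.-group <[x]>.
Proof. by move/group3; apply: (sigma_pi'_group parity_partitionP). Qed.

Let cardS4 : #|S4| = 24.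
Proof. by rewrite cardsT card_Sn. Qed.

Lemma S4_solvable : solvable S4.
Proof. by apply: Burnside_p_a_q_b; rewrite cardS4. Qed.

Let true_in_S4 : in_sigma parity_partition #|S4| true.
Proof. by exists 2; rewrite // cardS4. Qed.

(** Without the loop, [F] contains all involutions, hence the 3-cycles [s * t] and [t * u]. These
    lie in O_{2'}(F), and so does their product, the involution [a]: a contradiction. *)
Lemma S4_Hawkes_loop : edge (sigma_Hawkes_graph parity_partition S4) true true.
Proof.
apply: contrapT => /Hawkes_no_loopP pi'GF.
set F := sigma1_Fitting _ _ _ in pi'GF.
have nsFG : F <| S4 := sigma1_Fitting_normal parity_partitionP true S4.
have F2 x : x ^+ 2 = 1 -> x \in F.
  move/group2=> x2; rewrite -cycle_subG.
  by apply: quotient_pi'group_sub nsFG pi'GF (subsetT _) x2.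
have O3 x : x \in F -> x ^+ 3 = 1 -> x \in 'O_(parity_partition true)^'(F).
  move=> Fx /group3' x3; rewrite -cycle_subG.
  apply: (quotient_pi'group_sub (pcore_normal _ _) _ _ x3).
    rewrite pgroupNK; apply/(sigma1_nilpotentE parity_partitionP).
    exact: (@sigma1_Fitting_nil _ _ parity_partitionP).
  by rewrite cycle_subG.
have Oa : a \in 'O_(parity_partition true)^'(F).
  have -> : a = (s * t) * (t * u) by rewrite /a; compute_perm.
  by rewrite groupM ?O3 ?groupM ?F2.
case/eqP: a_neq1; apply/set1P.
rewrite -[[set 1]](pi_pi'_group1 (group2 a2)) ?cycle_id //.
by apply: pgroupS (pcore_pgroup _ F); rewrite cycle_subG.
Qed.

(** The 3-cycle [s * t] normalises the Klein four-group without centralising it. *)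
Lemma S4_VM_edge : edge (sigma_VM_graph parity_partition S4) true false.
Proof.
have cb : <[b]> \subset 'C(<[a]>).
  rewrite cycle_subG; apply/centP => y /cycleP[n ->].
  by apply: commuteX; apply: commute_sym.
have Aa : a \in <[a]> <*> <[b]> by rewrite mem_gen // inE cycle_id.
have Ab : b \in <[a]> <*> <[b]> by rewrite mem_gen // inE cycle_id orbT.
apply: (@noncentralizing_VM_edge _ _ parity_partitionP _ true false S4
         (<[a]> <*> <[b]>)%G <[s * t]>%G) => //.
- exact: subsetT.
- exact: subsetT.
- by rewrite /= cent_joinEr // pgroupM !group2.
- exact: group3.
- rewrite cycle_subG inE conjYg -!cycleJ conj_a conj_b join_subG !cycle_subG.
  by rewrite Ab groupM.
rewrite cycle_subG; apply/negP => /centP cst.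
case/eqP: a_neq_b; rewrite -conj_a conjgE -cst ?mulKg //.
Qed.

(** An odd prime dividing |N(H) : H C(H)| would make the Sylow 2-subgroup [H] normal; it would then
    contain every involution, hence the element [s * t] of order 3. *)
Lemma S4_Hall_not_edge :
  ~ edge (sigma_Hall_graph parity_partition S4) true false.
Proof.
case=> _ _ [H hallH [p]]; rewrite mem_primes => /and3P[pr_p _ dv_p].
rewrite inE pr_p /= => odd_p.
rewrite card_normalizer_quotient in dv_p.
have {dv_p} dv_p : p %| #|'N_S4(H) : H|.
  by apply: dvdn_trans dv_p _; rewrite indexgS ?joing_subl.
have sHN : H \subset 'N_S4(H) by rewrite subsetI subsetT normG.
have sNS4 : 'N_S4(H) \subset S4 := subsetIl _ _.
have iN := Lagrange_index sNS4 sHN.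
(* The index is odd and divides 24. *)
have iH3 : #|S4 : H| %| 3.
  have co8 : coprime #|S4 : H| 8.
    rewrite coprime_sym (@pnat_coprime (parity_partition true)) //.
    by have /and3P[] := hallH.
  by rewrite -(Gauss_dvdr _ co8) -[(8 * 3)%N]cardS4 dvdn_indexg.
have iNH : #|'N_S4(H) : H| = 3.
  have dvN3 : #|'N_S4(H) : H| %| 3.
    by apply: dvdn_trans iH3; rewrite -iN dvdn_mull.
  move: dvN3; rewrite dvdn_divisors // !inE => /orP[/eqP e1|/eqP //].
  by rewrite e1 dvdn1 in dv_p; rewrite (eqP dv_p) in pr_p.
have defN : S4 \subset 'N_S4(H).
  by move: iH3; rewrite -iN iNH (@dvdn_pmul2r 3 _ 1) // dvdn1 indexg_eq1.
have nsHG : H <| S4.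
  by rewrite /normal subsetT (subset_trans defN) ?subsetIr.
have H2 x : x ^+ 2 = 1 -> x \in H.
  by move/group2=> x2; rewrite -cycle_subG (sub_normal_Hall hallH) ?subsetT.
have Hst : <[s * t]> \subset H by rewrite cycle_subG groupM ?H2.
case/eqP: st_neq1; apply/set1P.
rewrite -[[set 1]](pi_pi'_group1 _ (group3' st3)) ?cycle_id //.
exact: pgroupS Hst (pHall_pgroup hallH).
Qed.

Let S4_neq1 : S4 :!=: 1.
Proof. by rewrite -cardG_gt1 cardS4. Qed.

Lemma Hall_VM_strict :
  exists (I : Type) (sigma : I -> nat_pred) (gT : finGroupType)
         (G : {group gT}),
    [/\ prime_partition sigma, G :!=: 1
      & proper_subgraph (sigma_Hall_graph sigma G) (sigma_VM_graph sigma G)].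
Proof.
exists bool, parity_partition, {perm 'I_4}, S4.
split=> //; first exact: parity_partitionP.
split; first exact: Hall_sub_VM parity_partitionP _ _.
by move=> eqG; apply: S4_Hall_not_edge; rewrite eqG; apply: S4_VM_edge.
Qed.

(** The difference is the loop at the class of 2, which solvability of Sym(4) forbids in the smaller
    graph. *)
Lemma VM_Hawkes_strict :
  exists (I : Type) (sigma : I -> nat_pred) (gT : finGroupType)
         (G : {group gT}),
    [/\ prime_partition sigma, G :!=: 1
      & proper_subgraph (sigma_VM_graph sigma G) (sigma_Hawkes_graph sigma G)].
Proof.
exists bool, parity_partition, {perm 'I_4}, S4.
split=> //; first exact: parity_partitionP.
split; first exact: VM_sub_Hawkes parity_partitionP _ _.
move=> eqG; apply: (VM_loopless parity_partitionP S4_solvable (x := true)).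
by rewrite eqG; apply: S4_Hawkes_loop.
Qed.

End SymmetricGroup4.

Theorem proposition1p2 :
  (* (1) *)
  [/\ forall (I : Type) (sigma : I -> nat_pred) (gT : finGroupType)
             (G : {group gT}),
        prime_partition sigma -> G :!=: 1 ->
        subgraph (sigma_Hall_graph sigma G) (sigma_VM_graph sigma G)
        /\ subgraph (sigma_VM_graph sigma G) (sigma_Hawkes_graph sigma G),
      exists (I : Type) (sigma : I -> nat_pred) (gT : finGroupType)
             (G : {group gT}),
        [/\ prime_partition sigma, G :!=: 1
          & proper_subgraph (sigma_Hall_graph sigma G) (sigma_VM_graph sigma G)]
    & exists (I : Type) (sigma : I -> nat_pred) (gT : finGroupType)
             (G : {group gT}),
        [/\ prime_partition sigma, G :!=: 1
          & proper_subgraph (sigma_VM_graph sigma G)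
                            (sigma_Hawkes_graph sigma G)]]
  /\
  (* (2) *)
  (forall (I : Type) (sigma : I -> nat_pred) (gT : finGroupType)
          (G : {group gT}),
     prime_partition sigma -> G :!=: 1 ->
     ((sigma_Hall_graph sigma G = sigma_VM_graph sigma G
       /\ sigma_VM_graph sigma G = sigma_Hawkes_graph sigma G)
      <-> loopless (sigma_Hawkes_graph sigma G))
     /\
     (loopless (sigma_Hawkes_graph sigma G)
      <-> sigma_soluble sigma G
          /\ (forall i, in_sigma sigma #|G| i ->
                pi_length (sigma i) G <= 1))).
Proof.
split; first split.
- move=> I sigma gT G sigmaP _.
  by split; [apply: Hall_sub_VM | apply: VM_sub_Hawkes].
- exact: Hall_VM_strict.
- exact: VM_Hawkes_strict.
move=> I sigma gT G sigmaP _.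
by split; [apply: eq_graphs_loopless | apply: loopless_HawkesP].
Qed.
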